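(* Let $q$ be a prime power and $n,k,t$ positive integers with $n\ge 2k+1$. Let $\mathcal F\subset \mathcal V_n^k$ be $t$-intersecting. Let $\alpha\in (0,1)$ and assume that no $t$-dimensional subspace is contained in more than an $\alpha$-fraction of the subspaces in $\mathcal F$. Then $$|\mathcal F| \le C (1-\alpha)^{-1} q^{(k-t)(n-k) - (n-k-t-1)},$$ where $C=2 \left( \frac{q}{q-1} \right)^{k-t+1} \left(1 + \frac{q+1}{q^2-q-1} \right)^2$ for $n=2k+1$ and $C=\left( \frac{q}{q-1} \right)^3 \left(1 + \frac{q+1}{q^2-q-1} \right)^2$ for $n \geq 2k+2$.
   Context: $V(n,q)$ is the $n$-dimensional vector space over the field with $q$ elements and $\mathcal V_n^k$ is the family of all its $k$-dimensional subspaces. A family of subspaces is $t$-intersecting if any two of its members (not necessarily distinct) intersect in a subspace of dimension at least $t$. The assumption on $\alpha$ means: for every $t$-dimensional subspace $T$ of $V(n,q)$, $|\{F\in\mathcal F: T\subset F\}|\le\alpha|\mathcal F|$. *)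

(* Defs.v *)
From HB Require Import structures.
From mathcomp Require Import all_boot all_order all_algebra all_field.

Set Implicit Arguments.
Unset Strict Implicit.
Unset Printing Implicit Defensive.

Import Order.TTheory GRing.Theory Num.Theory.
Import VectorInternalTheory.
Local Open Scope ring_scope.

(* Over a finite field there are finitely many subspaces; the library only
   makes {vspace _} a choiceType. This lets families of subspaces be {set _}. *)
HB.instance Definition _ (K : finFieldType) (vT : vectType K) :=
  [Countable of {vspace vT} by <:].
HB.instance Definition _ (K : finFieldType) (vT : vectType K) :=
  [Finite of {vspace vT} by <:].

Definition ksubspaces (K : finFieldType) (n k : nat) :
    {set {vspace 'rV[K]_n}} :=
  [set U : {vspace 'rV[K]_n} | \dim U == k].

Definition t_intersecting (K : finFieldType) (n t : nat)
    (Fam : {set {vspace 'rV[K]_n}}) : Prop :=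
  forall U W, U \in Fam -> W \in Fam -> (t <= \dim (U :&: W)%VS)%N.

Definition members_containing (K : finFieldType) (n : nat)
    (Fam : {set {vspace 'rV[K]_n}}) (T : {vspace 'rV[K]_n}) :
    {set {vspace 'rV[K]_n}} :=
  [set U in Fam | (T <= U)%VS].

(* The exponent k - t + 1 is a signed integer: k < t is not excluded. *)
Definition boundC (R : realFieldType) (q n k t : nat) : R :=
  let Q : R := q%:R in
  if (n == 2 * k + 1)%N
  then 2 * (Q / (Q - 1)) ^ (k%:Z - t%:Z + 1)
         * (1 + (Q + 1) / (Q ^+ 2 - Q - 1)) ^+ 2
  else (Q / (Q - 1)) ^+ 3 * (1 + (Q + 1) / (Q ^+ 2 - Q - 1)) ^+ 2.

(* Main.v *)
Require Import Defs.
From mathcomp Require Import all_boot all_order all_algebra all_field.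
From mathcomp Require Import ring lra zify.

Set Implicit Arguments.
Unset Strict Implicit.
Unset Printing Implicit Defensive.

Import Order.TTheory GRing.Theory Num.Theory.
Local Open Scope ring_scope.

(** The proof peels the family. Say that M refines F if every member of F
    contains a member of M. Starting from M = F, shrink members of M to proper
    subspaces as long as M stays t-intersecting. When this stops, M is
    irreducible: every proper subspace Y of a member of M meets some
    member Z of M in dimension less than t ([irreducible_refinement]).

    Irreducibility bounds the number of members of M of the maximal dimension
    m. Let Y be a proper subspace of such a member. All members X of dimension
    m above Y meet Z in dimension at least t, while Y does not, so every such X
    picks up many of the few vectors of Z outside Y. Double counting the pairs
    (X, z) bounds the number of X above Y by avoid_ratio times the largest
    number of members above some Y + <z> ([double_count_avoiding]). Iterating
    from Y = 0 up to dimension m gives a product of m ratios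
    ([count_above], [card_top_layer]), of order q^(m (m - t)). With
    Z the whole space, the same lemma gives the upper bound of order
    q^((k - m) (n - k)) for the number of k-spaces above a fixed m-space.

    Now delete from F the spaces above the members of M of dimension m, and
    from M those members; the rest of M is t-intersecting with dimensions at
    most m - 1, and the process goes on with m - 1. At m = t only one
    t-dimensional subspace can be left, and at most alpha |F| members of F lie
    above it. Hence (1 - alpha) |F| is at most the sum over t < m <= k of
    the products of the two bounds ([peeling]).

    Up to constants the m-th term is q^(m (m - t) + (k - m) (n - k)). Write
    L = k - t - 1, m = t + 1 + j and n = 2k + 1 + u. The exponent then drops
    from its value at j = 0 by j (L - j + u) ([layer_exponent]). It is convex
    in j, so the sum concentrates at the two ends. For u = 0 both ends
    j = 0 and j = L are equally large, which is the reason for the factor 2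
    and for the power of q / (q - 1) depending on k - t; for u > 0 the
    end j = 0 wins. The squared constant of the theorem comes from
    Euler's product: the product of the 1 - x^j is at least 1 - x - x^2 at
    x = 1/q, once for each of the two counts. *)

(** * Counting members of a family above a subspace *)

(** The number of vectors of an m-space outside an s-dimensional subspace,
    divided by the same number for a t-space. *)
Definition avoid_ratio (R : realFieldType) (Q : R) (m t s : nat) : R :=
  (Q ^+ m - Q ^+ s) / (Q ^+ t - Q ^+ s).

Lemma card_field_gt1 (R : realFieldType) (K : finFieldType) :
  1 < #|K|%:R :> R.
Proof. by rewrite ltr1n finNzRing_gt1. Qed.

Lemma subX_gt0 (R : realFieldType) (Q : R) (t s : nat) :
  1 < Q -> (s < t)%N -> 0 < Q ^+ t - Q ^+ s.
Proof. by move=> Q1 st; rewrite subr_gt0 ltr_eXn2l. Qed.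

Lemma avoid_ratio_ge0 (R : realFieldType) (Q : R) (m t s : nat) :
  1 < Q -> (s < t <= m)%N -> 0 <= avoid_ratio Q m t s.
Proof.
move=> Q1 /andP[st tm]; apply: divr_ge0; apply: ltW; apply: subX_gt0 => //.
exact: leq_trans tm.
Qed.

Lemma card_vspaceD (R : realFieldType) (K : finFieldType) (n : nat)
    (U Y : {vspace 'rV[K]_n}) :
  #|[set z | (z \in U) && (z \notin Y)]|%:R =
    #|K|%:R ^+ \dim U - #|K|%:R ^+ \dim (Y :&: U)%VS :> R.
Proof.
have -> : [set z | (z \in U) && (z \notin Y)] =
    [set z | z \in U] :\: [set z | z \in (Y :&: U)%VS].
  by apply/setP=> z; rewrite !inE memv_cap; case: (z \in U); case: (z \in Y).
rewrite cardsD; have -> : [set z | z \in U] :&: [set z | z \in (Y :&: U)%VS] =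
    [set z | z \in (Y :&: U)%VS].
  by apply/setP=> z; rewrite !inE memv_cap; case: (z \in U); case: (z \in Y).
rewrite !cardsE !card_vspace natrB ?natrX //.
by rewrite leq_exp2l ?finNzRing_gt1 // dimvS ?capvSr.
Qed.

(** Count the pairs (X, z) with X a member above Y and z in X and Z but not in
    Y. Each X occurs at least q^t - q^s' times with s' = dim (Y :&: Z), there
    are at most q^m - q^s' vectors z, and each occurs with the members above
    Y + <z> only. *)
Lemma double_count_avoiding (R : realFieldType) (K : finFieldType) (n : nat)
    (W : {set {vspace 'rV[K]_n}}) (Y Z : {vspace 'rV[K]_n})
    (m t s : nat) (B : R) :
    0 <= B -> (s < t <= m)%N -> (\dim Z <= m)%N -> (\dim (Y :&: Z) <= s)%N ->
    (forall X, X \in W -> (t <= \dim (X :&: Z))%N) ->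
    (forall z, z \notin Y -> #|members_containing W (Y + <[z]>)%VS|%:R <= B) ->
  #|members_containing W Y|%:R <= avoid_ratio #|K|%:R m t s * B.
Proof.
move=> B0 /andP[st tm] Zm YZs WZ WB.
set Q : R := #|K|%:R; have Q1 : 1 < Q := card_field_gt1 R K.
set s' := \dim (Y :&: Z)%VS in YZs *.
set N : R := #|members_containing W Y|%:R.
have N0 : 0 <= N by exact: ler0n.
have s't : (s' < t)%N by exact: leq_ltn_trans st.
have key : N * (Q ^+ t - Q ^+ s') <= (Q ^+ m - Q ^+ s') * B.
  pose pairs : R := \sum_(X in members_containing W Y)
    \sum_(z | (z \in (X :&: Z)%VS) && (z \notin Y)) 1.
  apply: (@le_trans _ _ pairs).
    rewrite mulr_natl -sumr_const; apply: ler_sum => X.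
    rewrite inE => /andP[XW YX].
    rewrite sumr_const -cardsE card_vspaceD lerB ?ler_weXn2l ?WZ ?(ltW Q1) //.
    by apply/dimvS/capvS => //; exact: capvSr.
  have -> : pairs = \sum_(z | (z \in Z) && (z \notin Y))
      #|members_containing W (Y + <[z]>)%VS|%:R.
    rewrite /pairs (exchange_big_dep (fun z => (z \in Z) && (z \notin Y))) /=.
      apply: eq_bigr => z /andP[zZ zY].
      rewrite -sumr_const; apply: eq_bigl => X.
      by rewrite !inE memv_cap zZ zY subv_add -memvE !andbT -andbA.
    by move=> X z _; rewrite memv_cap => /andP[/andP[_ ->] ->].
  apply: (@le_trans _ _ (\sum_(z | (z \in Z) && (z \notin Y)) B)).
    by apply: ler_sum => z /andP[_ zY]; exact: WB.
  rewrite sumr_const -[X in X <= _]mulr_natl -cardsE card_vspaceD.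
  by apply: ler_wpM2r => //; rewrite lerD2r ler_weXn2l // ltW.
rewrite /avoid_ratio mulrAC ler_pdivlMr ?subX_gt0 //.
have a1 : 0 < Q ^+ t - Q ^+ s' by exact: subX_gt0.
rewrite -(ler_pM2r a1).
have h1 : Q ^+ s' <= Q ^+ s by rewrite ler_weXn2l // ltW.
have h2 : Q ^+ t <= Q ^+ m by rewrite ler_weXn2l // ltW.
have h3 : 0 < Q ^+ t - Q ^+ s by exact: subX_gt0.
(* Passing from s' to the larger s increases the ratio, as t <= m. *)
have h4 : (Q ^+ m - Q ^+ s') * (Q ^+ t - Q ^+ s) <=
    (Q ^+ m - Q ^+ s) * (Q ^+ t - Q ^+ s').
  rewrite -subr_ge0.
  have -> : (Q ^+ m - Q ^+ s) * (Q ^+ t - Q ^+ s') -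
     (Q ^+ m - Q ^+ s') * (Q ^+ t - Q ^+ s) =
     (Q ^+ s - Q ^+ s') * (Q ^+ m - Q ^+ t) by ring.
  by rewrite mulr_ge0 ?subr_ge0.
apply: (@le_trans _ _ ((Q ^+ m - Q ^+ s') * B * (Q ^+ t - Q ^+ s))).
  by rewrite mulrAC ler_pM2r.
by rewrite mulrAC [X in _ <= X]mulrAC ler_wpM2r.
Qed.

(** Climbing from Y one dimension at a time, with a suitable Z at each stage,
    until the dimension l of the members is reached, where only Y itself can
    lie above Y. *)
Lemma count_above (R : realFieldType) (K : finFieldType) (n : nat)
    (W : {set {vspace 'rV[K]_n}}) (l m t : nat) (s : nat -> nat) :
    W \subset ksubspaces K n l ->
    (forall d, (d < l)%N -> (s d < t <= m)%N) ->
    (forall X Y, X \in W -> (Y <= X)%VS -> (\dim Y < l)%N -> exists Z,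
       [/\ (\dim Z <= m)%N, (\dim (Y :&: Z) <= s (\dim Y))%N &
           forall X', X' \in W -> (t <= \dim (X' :&: Z))%N]) ->
  forall Y, #|members_containing W Y|%:R <=
    \prod_(\dim Y <= d < l) avoid_ratio #|K|%:R m t (s d) :> R.
Proof.
move=> Wl st avoid Y.
have [r] := ubnP (l - \dim Y); elim: r Y => // r IHr Y hr.
set W' := members_containing W Y.
have prod0 : forall a, 0 <= \prod_(a <= d < l) avoid_ratio #|K|%:R m t (s d) :> R.
  move=> a; rewrite big_nat; apply: prodr_ge0 => d /andP[_ dl].
  by apply: avoid_ratio_ge0; [exact: card_field_gt1 | exact: st].
have [W'0 | /set0Pn[X]] := eqVneq W' set0; first by rewrite W'0 cards0 prod0.
rewrite inE => /andP[XW YX].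
have dimW U : U \in W -> \dim U = l.
  by move=> UW; have := subsetP Wl _ UW; rewrite inE => /eqP.
have [Yl | lY] := ltnP (\dim Y) l; last first.
  rewrite big_geq // -[1]/(1%:R) ler_nat.
  apply: (@leq_trans #|[set Y]|); last by rewrite cards1.
  apply: subset_leq_card.
  apply/subsetP=> U; rewrite !inE => /andP[UW YU].
  by rewrite eq_sym -(geq_leqif (dimv_leqif_eq YU)) (dimW _ UW).
have [Z [Zm YZ WZ]] := avoid _ _ XW YX Yl.
rewrite big_ltn //; apply: (double_count_avoiding _ (st _ Yl) Zm YZ WZ) => //.
move=> z zY.
have dYz : \dim (Y + <[z]>) = (\dim Y).+1.
  rewrite dimv_disjoint_sum ?dim_vline.
    by have [z0|] := eqVneq z 0; [rewrite z0 mem0v in zY | rewrite addn1].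
  apply/eqP; rewrite -subv0; apply/subvP=> v /memv_capP[vY /vlineP[a va]].
  rewrite memv0; have [a0|a0] := eqVneq a 0; first by rewrite va a0 scale0r.
  move: zY; rewrite -[z](scalerK a0) -va memvZ //.
by rewrite -dYz; apply: IHr; rewrite dYz; lia.
Qed.

(** * Irreducible refinements *)

Definition refines (K : finFieldType) (n : nat)
    (M F : {set {vspace 'rV[K]_n}}) : bool :=
  [forall X in F, exists Y in M, (Y <= X)%VS].

Lemma refinesP (K : finFieldType) (n : nat) (M F : {set {vspace 'rV[K]_n}}) :
  reflect (forall X, X \in F -> exists2 Y, Y \in M & (Y <= X)%VS) (refines M F).
Proof.
apply: (iffP forall_inP) => h X XF.
  by have /exists_inP := h _ XF.
by apply/exists_inP; apply: h.
Qed.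

Lemma refines_trans (K : finFieldType) (n : nat)
    (A B C : {set {vspace 'rV[K]_n}}) :
  refines A B -> refines B C -> refines A C.
Proof.
move=> /refinesP AB /refinesP BC; apply/refinesP => X /BC[Y /AB[Z ZA ZY] YX].
by exists Z => //; exact: subv_trans YX.
Qed.

Definition t_irreducible (K : finFieldType) (n t : nat)
    (M : {set {vspace 'rV[K]_n}}) : Prop :=
  forall X Y, X \in M -> (Y <= X)%VS -> Y != X ->
    exists2 Z, Z \in M & (\dim (Y :&: Z) < t)%N.

(** Among the t-intersecting refinements of T with dimensions at most m, take
    one minimising the sum of the dimensions of its members. If a proper
    subspace Y of a member X met all members in dimension at least t, then
    replacing X by Y would give a smaller one. *)
Lemma irreducible_refinement (K : finFieldType) (n t m : nat)
    (T : {set {vspace 'rV[K]_n}}) :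
    t_intersecting t T -> (forall X, X \in T -> (\dim X <= m)%N) ->
  exists M, [/\ t_intersecting t M, forall X, X \in M -> (\dim X <= m)%N,
                refines M T & t_irreducible t M].
Proof.
move=> Tint Tm.
pose ok (M : {set {vspace 'rV[K]_n}}) :=
  [&& [forall U in M, forall W in M, t <= \dim (U :&: W)%VS],
      [forall X in M, \dim X <= m] & refines M T]%N.
have okP M : reflect [/\ t_intersecting t M,
    forall X, X \in M -> (\dim X <= m)%N & refines M T] (ok M).
  apply: (iffP and3P) => [][h1 h2 h3]; split=> //.
  - by move=> U W UM WM; exact: (forall_inP (forall_inP h1 U UM)).
  - exact/forall_inP.
  - by apply/forall_inP => U UM; apply/forall_inP => W; exact: h1.
  - exact/forall_inP.
have okT : ok T by apply/okP; split=> //; apply/refinesP => X XT; exists X.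
case: (arg_minnP (fun M : {set {vspace 'rV[K]_n}} => \sum_(X in M) \dim X)%N okT).
move=> M /okP[Mint Mm MT] Mmin; exists M; split=> // X Y XM YX YneX.
have [/exists_inP //|/exists_inPn noZ] :=
  boolP [exists Z in M, (\dim (Y :&: Z) < t)%N].
have dimYX : (\dim Y < \dim X)%N by rewrite (ltn_leqif (dimv_leqif_eq YX)).
have YZ Z : Z \in M -> (t <= \dim (Y :&: Z))%N.
  by move=> ZM; rewrite leqNgt noZ.
(* In M' the subspace Y may already have been a member of M. *)
pose M' := Y |: M :\ X.
suff okM' : ok M'.
  have := Mmin _ okM'; rewrite (big_setD1 X XM) /=.
  have : (\sum_(U in M') \dim U <= \dim Y + \sum_(U in M :\ X) \dim U)%N.
    have [YM|YM] := boolP (Y \in M :\ X).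
      by rewrite /M' (setUidPr _) ?sub1set // leq_addl.
    by rewrite big_setU1.
  move=> sumM' sumM; have := leq_trans sumM sumM'.
  by rewrite leq_add2r leqNgt dimYX.
apply/okP; split.
- move=> U V; rewrite !inE => /predU1P[->|/andP[_ UM]] /predU1P[->|/andP[_ VM]].
  + rewrite capvv; apply: leq_trans (YZ _ XM) _; exact/dimvS/capvSl.
  + exact: YZ.
  + by rewrite capvC; exact: YZ.
  + exact: Mint.
- move=> U; rewrite !inE => /predU1P[->|/andP[_]]; last exact: Mm.
  exact: leq_trans (ltnW dimYX) (Mm _ XM).
- apply: refines_trans MT; apply/refinesP => U UM.
  have [->|UX] := eqVneq U X; first by exists Y; rewrite ?setU11.
  by exists U => //; rewrite !inE UX UM orbT.
Qed.

(** * Peeling *)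

(** Equal to the Gaussian binomial coefficient of n - i over k - i. *)
Definition superspace_bound (R : realFieldType) (Q : R) (n k i : nat) : R :=
  \prod_(i <= d < k) avoid_ratio Q n k d.

(** At dimension d < t every member of an irreducible family may serve as Z,
    and it meets Y in dimension at most d; from dimension t on, irreducibility
    provides a Z meeting Y in dimension at most t - 1. *)
Definition layer_bound (R : realFieldType) (Q : R) (t i : nat) : R :=
  \prod_(0 <= d < i) avoid_ratio Q i t (minn d t.-1).

(** Apply [count_above] with Z the whole space, which meets every k-space in
    dimension k. *)
Lemma card_superspaces (R : realFieldType) (K : finFieldType) (n k : nat)
    (Y : {vspace 'rV[K]_n}) : (k <= n)%N ->
  #|members_containing (ksubspaces K n k) Y|%:R <=
    superspace_bound (#|K|%:R : R) n k (\dim Y).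
Proof.
move=> kn; apply: (@count_above R K n _ k n k id) => //; first by move=> d ->.
move=> X U; rewrite inE => /eqP Xk UX Uk; exists fullv; split.
- by rewrite dimvf /dim /= mul1n.
- by rewrite capvf.
- by move=> X'; rewrite inE capvf => /eqP ->.
Qed.

Lemma card_top_layer (R : realFieldType) (K : finFieldType) (n t m : nat)
    (M : {set {vspace 'rV[K]_n}}) :
    (0 < t <= m)%N -> t_intersecting t M ->
    (forall X, X \in M -> (\dim X <= m)%N) -> t_irreducible t M ->
  #|[set X in M | \dim X == m]|%:R <= layer_bound (#|K|%:R : R) t m.
Proof.
move=> /andP[t0 tm] Mint Mm Mirr.
set W := [set X in M | \dim X == m].
have WM X : X \in W -> X \in M by rewrite inE => /andP[].
have -> : #|W| = #|members_containing W 0%VS|.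
  by apply: eq_card => X; rewrite !inE sub0v andbT.
have := @count_above R K n W m m t (fun d => minn d t.-1).
move=> /(_ _ _ _ 0%VS); rewrite dimv0; apply.
- by apply/subsetP => X; rewrite !inE => /andP[].
- by move=> d dm; rewrite tm andbT; lia.
move=> X Y XW YX Ym; have XM := WM _ XW.
have [Yt|tY] := ltnP (\dim Y) t.
  exists X; split=> [||X' /WM X'M]; [exact: Mm| |exact: Mint].
  rewrite (_ : minn _ _ = \dim Y); last by lia.
  exact/dimvS/capvSl.
have [|Z ZM YZ] := Mirr X Y XM YX.
  apply: contraL Ym => /eqP ->.
  by move: XW; rewrite inE => /andP[_ /eqP ->]; rewrite ltnn.
exists Z; split=> [||X' /WM X'M]; [exact: Mm| lia |exact: Mint].
Qed.

(** Induction on m - t. An irreducible refinement M of T still refines F. The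
    members of F above an m-dimensional member of M are counted by the last
    term of the sum; the others are refined by the members of M of smaller
    dimension. For m = t all members of T have dimension t, so two of
    them meeting in dimension t coincide. *)
Lemma peeling (R : realFieldType) (K : finFieldType) (n k t m : nat)
    (T F : {set {vspace 'rV[K]_n}}) (a : R) :
    (0 < t <= m)%N -> (k <= n)%N -> 0 <= a ->
    t_intersecting t T -> (forall X, X \in T -> (\dim X <= m)%N) ->
    F \subset ksubspaces K n k -> refines T F ->
    (forall S, \dim S = t -> #|members_containing F S|%:R <= a) ->
  #|F|%:R <= a + \sum_(t.+1 <= i < m.+1)
    layer_bound #|K|%:R t i * superspace_bound #|K|%:R n k i.
Proof.
move=> /andP[t0 tm] kn a0; rewrite -(subnKC tm); move: (m - t)%N => r {m tm}.
elim: r T F => [|r IHr] T F Tint Tm Fk TF Fa.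
  rewrite addn0 big_geq // addr0.
  have [T0|/set0Pn[S ST]] := eqVneq T set0.
    suff -> : F = set0 by rewrite cards0.
    apply/setP=> X; rewrite in_set0; apply/negP => XF.
    by have /refinesP/(_ _ XF)[Y] := TF; rewrite T0 inE.
  have dimT U : U \in T -> \dim U = t.
    move=> UT; apply/eqP; rewrite eqn_leq -{2}[U]capvv Tint // andbT.
    by have := Tm _ UT; rewrite addn0.
  have TS U : U \in T -> U = S.
    move=> UT; have h := Tint _ _ UT ST; apply/eqP.
    have /eqP <- : (U :&: S == U)%VS.
      by rewrite -(geq_leqif (dimv_leqif_eq (capvSl U S))) dimT.
    by rewrite -(geq_leqif (dimv_leqif_eq (capvSr U S))) dimT.
  apply: le_trans (Fa S (dimT _ ST)); rewrite ler_nat subset_leq_card //.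
  apply/subsetP => X XF; rewrite inE XF /=.
  by have /refinesP/(_ _ XF)[Y /TS ->] := TF.
have [M [Mint Mm MT Mirr]] := irreducible_refinement Tint Tm.
set m := (t + r.+1)%N in Tm Mm *.
have tm : (0 < t <= m)%N by rewrite t0 leq_addr.
pose W := [set X in M | \dim X == m].
pose F' := [set X in F | ~~ [exists Y in W, (Y <= X)%VS]].
have F'F : F' \subset F by apply/subsetP => X; rewrite inE => /andP[].
have boundF' : #|F'|%:R <= a + \sum_(t.+1 <= i < m)
    layer_bound #|K|%:R t i * superspace_bound #|K|%:R n k i.
  rewrite /m addnS; apply: (IHr (M :\: W) F').
  - by move=> U V; rewrite !inE => /andP[_ UM] /andP[_ VM]; exact: Mint.
  - move=> X; rewrite !inE => /andP[+ XM]; rewrite XM /= => Xm.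
    by have := Mm _ XM; rewrite leq_eqVlt (negPf Xm) /m addnS ltnS.
  - exact: subset_trans Fk.
  - apply/refinesP => X; rewrite inE => /andP[XF /exists_inPn noW].
    have /refinesP/(_ _ XF)[Y YM YX] := refines_trans MT TF.
    exists Y => //; rewrite inE YM andbT; apply/negP => YW.
    by have := noW _ YW; rewrite YX.
  - move=> S St; apply: le_trans (Fa S St); rewrite ler_nat subset_leq_card //.
    by apply/subsetP=> X; rewrite !inE => /andP[/andP[-> _] ->].
rewrite big_nat_recr /= ?addrA; last by rewrite /m; lia.
have sup0 : 0 <= superspace_bound (#|K|%:R : R) n k m.
  rewrite /superspace_bound big_nat; apply: prodr_ge0 => d /andP[_ dk].
  by rewrite avoid_ratio_ge0 ?card_field_gt1 ?dk.
have boundW : #|F :\: F'|%:R <=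
    layer_bound #|K|%:R t m * superspace_bound (#|K|%:R : R) n k m.
  apply: (@le_trans _ _ (#|W|%:R * superspace_bound #|K|%:R n k m)); last first.
    by apply: ler_wpM2r => //; exact: card_top_layer.
  rewrite mulr_natl.
  apply: (@le_trans _ _ (\sum_(Y in W)
      #|members_containing (ksubspaces K n k) Y|%:R)); last first.
    rewrite -sumr_const; apply: ler_sum => Y; rewrite inE => /andP[_ /eqP Ym].
    by rewrite -Ym; exact: card_superspaces.
  rewrite -natr_sum ler_nat.
  apply: (@leq_trans #|\bigcup_(Y in W) members_containing (ksubspaces K n k) Y|).
    apply/subset_leq_card/subsetP => X.
    rewrite !inE => /andP[+ XF]; rewrite XF /= negbK => /exists_inP[Y YW YX].
    apply/bigcupP; exists Y => //; rewrite inE YX andbT.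
    exact: (subsetP Fk).
  apply: (big_ind2 (fun (A : {set _}) b => #|A| <= b)%N) => //.
    by rewrite cards0.
  move=> A a' B b' Aa Bb; apply: leq_trans (leq_add Aa Bb).
  exact: (leq_card_setU A B).1.
rewrite -(cardsID F' F) natrD lerD //.
by rewrite (setIidPr F'F).
Qed.

(** * Estimating the two counts *)

Lemma avoid_ratio_le (R : realFieldType) (Q : R) (m t s : nat) :
    1 < Q -> (s < t <= m)%N ->
  avoid_ratio Q m t s <= Q ^+ (m - t) * (1 - Q^-1 ^+ (t - s))^-1.
Proof.
move=> Q1 /andP[st tm]; have Q0 : 0 < Q by exact: lt_trans Q1.
have Qt0 := subX_gt0 Q1 st.
have -> : 1 - Q^-1 ^+ (t - s) = (Q ^+ t - Q ^+ s) / Q ^+ t.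
  rewrite mulrBl divff ?expf_neq0 ?gt_eqF // -{2}(subnK (ltnW st)) exprD.
  by rewrite exprVn invfM mulrCA divff ?mulr1 // expf_neq0 ?gt_eqF.
rewrite invf_div mulrA -exprD subnK // /avoid_ratio ler_pM2r ?invr_gt0 //.
by rewrite gerBl exprn_ge0 ?ltW.
Qed.

(** A truncation of Euler's pentagonal number theorem. The last term on the
    left, which decreases with b, is what makes the induction go through. *)
Lemma euler_prod_ge (R : realFieldType) (x : R) (b : nat) :
    0 <= x -> x <= 2^-1 ->
  1 - x - x ^+ 2 + x ^+ b.+2 <= \prod_(1 <= j < b.+2) (1 - x ^+ j).
Proof.
move=> x0 x2; elim: b => [|b IHb].
  by rewrite big_nat1 expr1 subrK.
rewrite big_nat_recr //=.
have xb : x ^+ b.+2 <= 1 by rewrite exprn_ile1 //; lra.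
have xb' : 0 <= 1 - x ^+ b.+2 by rewrite subr_ge0.
apply: le_trans (ler_wpM2r xb' IHb).
have : x ^+ (b.+2 + b.+2) <= x ^+ b.+4.
  by rewrite ler_wiXn2l //; [lra | lia].
rewrite exprD !exprS; nra.
Qed.

Lemma prod_inv_euler_le (R : realFieldType) (x : R) (a b : nat) :
    0 <= x -> x <= 2^-1 -> (a <= b)%N ->
  \prod_(a <= d < b) (1 - x ^+ (b - d))^-1 <= (1 - x - x ^+ 2)^-1.
Proof.
move=> x0 x2 ab; have D0 : 0 < 1 - x - x ^+ 2 by nra.
rewrite prodfV lef_pV2 ?posrE //; last first.
  rewrite big_nat; apply: prodr_gt0 => d /andP[_ db].
  by rewrite subr_gt0 exprn_ilt1 -?lt0n ?subn_gt0 //; lra.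
have -> : \prod_(a <= d < b) (1 - x ^+ (b - d)) =
    \prod_(1 <= j < (b - a).+1) (1 - x ^+ j).
  rewrite big_nat_rev -{1}[a]add0n big_addn big_add1 /=.
  by apply: eq_big_nat => d db; congr (1 - x ^+ _); lia.
case: (b - a)%N => [|c]; first by rewrite big_geq //; nra.
apply: le_trans (euler_prod_ge c x0 x2).
by rewrite lerDl exprn_ge0.
Qed.

Lemma superspace_bound_le (R : realFieldType) (Q : R) (n k i : nat) :
    2 <= Q -> (i <= k <= n)%N ->
  superspace_bound Q n k i <=
    (1 - Q^-1 - Q^-1 ^+ 2)^-1 * Q ^+ ((k - i) * (n - k)).
Proof.
move=> Q2 /andP[ik kn]; have Q1 : 1 < Q by lra.
have x2 : Q^-1 <= 2^-1 by rewrite lef_pV2 ?posrE //; lra.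
have x0 : 0 <= Q^-1 by rewrite invr_ge0; lra.
apply: (@le_trans _ _ (\prod_(i <= d < k) (Q ^+ (n - k) * (1 - Q^-1 ^+ (k - d))^-1))).
  rewrite /superspace_bound !big_nat; apply: ler_prod => d /andP[_ dk].
  by rewrite avoid_ratio_ge0 ?avoid_ratio_le ?dk.
rewrite big_split /= prodr_const_nat -exprM mulrC [((k - i) * _)%N]mulnC.
by rewrite ler_wpM2r ?exprn_ge0 ?prod_inv_euler_le //; lra.
Qed.

Lemma layer_bound_le (R : realFieldType) (Q : R) (t i : nat) :
    2 <= Q -> (0 < t <= i)%N ->
  layer_bound Q t i <=
    (1 - Q^-1 - Q^-1 ^+ 2)^-1 * (1 - Q^-1)^-1 ^+ (i - t) * Q ^+ (i * (i - t)).
Proof.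
move=> Q2 /andP[t0 ti]; have Q1 : 1 < Q by lra.
have x2 : Q^-1 <= 2^-1 by rewrite lef_pV2 ?posrE //; lra.
have x0 : 0 <= Q^-1 by rewrite invr_ge0; lra.
have Qi0 : 0 <= Q ^+ (i - t) by rewrite exprn_ge0 //; lra.
have ok d : (minn d t.-1 < t <= i)%N by lia.
rewrite /layer_bound (big_cat_nat (leq0n t) ti) /=.
have low : \prod_(0 <= d < t) avoid_ratio Q i t (minn d t.-1) <=
    (1 - Q^-1 - Q^-1 ^+ 2)^-1 * Q ^+ ((i - t) * t).
  apply: (@le_trans _ _ (\prod_(0 <= d < t)
      (Q ^+ (i - t) * (1 - Q^-1 ^+ (t - d))^-1))).
    rewrite !big_nat; apply: ler_prod => d /andP[_ dt].
    rewrite avoid_ratio_ge0 //= (_ : minn d t.-1 = d); last by lia.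
    by rewrite avoid_ratio_le ?dt.
  rewrite big_split /= prodr_const_nat subn0 -exprM mulrC.
  by rewrite ler_wpM2r ?exprn_ge0 ?prod_inv_euler_le //; lra.
have high : \prod_(t <= d < i) avoid_ratio Q i t (minn d t.-1) <=
    (1 - Q^-1)^-1 ^+ (i - t) * Q ^+ ((i - t) * (i - t)).
  apply: (@le_trans _ _ (\prod_(t <= d < i) (Q ^+ (i - t) * (1 - Q^-1)^-1))).
    rewrite !big_nat; apply: ler_prod => d /andP[td _].
    rewrite avoid_ratio_ge0 //= (_ : minn d t.-1 = t.-1); last by lia.
    apply: le_trans (avoid_ratio_le Q1 _) _; first by lia.
    by rewrite (_ : (t - t.-1)%N = 1%N) //; lia.
  by rewrite prodr_const_nat exprMn mulrC -exprM.
apply: (le_trans (ler_pM _ _ low high)).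
- by rewrite big_nat; apply: prodr_ge0 => d _; rewrite avoid_ratio_ge0.
- by rewrite big_nat; apply: prodr_ge0 => d _; rewrite avoid_ratio_ge0.
rewrite mulrACA -exprD (_ : (i - t) * t + (i - t) * (i - t) = i * (i - t))%N //.
by rewrite -mulnDr subnKC // mulnC.
Qed.

(** * Summing over the dimensions *)

Lemma geometric_le (R : realFieldType) (x : R) (b : nat) :
  0 <= x -> x < 1 -> \sum_(j < b) x ^+ j <= (1 - x)^-1.
Proof.
move=> x0 x1; have y0 : 0 < 1 - x by lra.
rewrite -(ler_pM2l y0) divff ?gt_eqF //.
have -> : (1 - x) * \sum_(j < b) x ^+ j = 1 - x ^+ b.
  by rewrite -opprB mulNr -subrX1 opprB.
by rewrite gerBl exprn_ge0.
Qed.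

(** The exponent j (L - j) is at least j if j < L and vanishes at j = L, so
    each term is at most x^j + x^(L - j). *)
Lemma sum_two_ends (R : realFieldType) (x : R) (L : nat) :
  0 <= x -> x < 1 -> \sum_(j < L.+1) x ^+ (j * (L - j)) <= 2 * (1 - x)^-1.
Proof.
move=> x0 x1.
apply: (@le_trans _ _ (\sum_(j < L.+1) (x ^+ j + x ^+ (L - j)))).
  apply: ler_sum => j _; have := ltn_ord j; rewrite ltnS leq_eqVlt.
  case/predU1P=> [->|jL]; first by rewrite subnn muln0 expr0 lerDr exprn_ge0.
  apply: le_trans (_ : x ^+ j <= _); last by rewrite lerDl exprn_ge0.
  by rewrite ler_wiXn2l ?leq_pmulr ?subn_gt0 // ltW.
rewrite big_split /=.
have -> : \sum_(j < L.+1) x ^+ (L - j) = \sum_(j < L.+1) x ^+ j.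
  rewrite (reindex_inj rev_ord_inj) /=; apply: eq_bigr => j _.
  by congr (_ ^+ _); have := ltn_ord j; lia.
by rewrite mulr_natl mulr2n lerD ?geometric_le.
Qed.

(** The case n = 2k + 1: the largest power of 1 / (1 - 1/q) is taken out, and
    two geometric series remain, one for each end. *)
Lemma layer_sum_critical (R : realFieldType) (Q : R) (L : nat) :
  2 <= Q -> \sum_(j < L.+1) (1 - Q^-1)^-1 ^+ j.+1 * Q^-1 ^+ (j * (L - j)) <=
    2 * (1 - Q^-1)^-1 ^+ L.+2.
Proof.
move=> Q2; have x2 : Q^-1 <= 2^-1 by rewrite lef_pV2 ?posrE //; lra.
have x0 : 0 < Q^-1 by rewrite invr_gt0; lra.
set x := Q^-1 in x0 x2 *.
have p1 : 1 <= (1 - x)^-1 by rewrite invf_ge1; lra.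
apply: (@le_trans _ _ (\sum_(j < L.+1) (1 - x)^-1 ^+ L.+1 * x ^+ (j * (L - j)))).
  apply: ler_sum => j _; rewrite ler_wpM2r ?exprn_ge0 ?(ltW x0) //.
  by rewrite ler_weXn2l.
rewrite -mulr_sumr [_ ^+ L.+2]exprSr mulrCA ler_wpM2l ?sum_two_ends ?(ltW x0) //.
  by rewrite exprn_ge0 // (le_trans _ p1).
lra.
Qed.

(** The case n > 2k + 1. With p = 1 / (1 - 1/q), the additional factor q^(-j)
    turns p^j into (p / q)^j = (q - 1)^(-j). For q = 2 this is 1 and the sum is
    bounded from both ends, with 2 p = p^2; for q >= 3 the geometric series
    in 1 / (q - 1) is already at most p^2. Here it matters that q is an integer:
    the two arguments together leave a gap between 2 and 3. *)
Lemma layer_sum_large (R : realFieldType) (q : nat) (L u : nat) : (1 < q)%N ->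
  \sum_(j < L.+1) (1 - q%:R^-1)^-1 ^+ j.+1 * q%:R^-1 ^+ (j * (L - j + u.+1)) <=
    (1 - q%:R^-1)^-1 ^+ 3 :> R.
Proof.
move=> q2; set Q : R := q%:R; have Q2 : 2 <= Q by rewrite ler_nat.
have x2 : Q^-1 <= 2^-1 by rewrite lef_pV2 ?posrE //; lra.
have x0 : 0 < Q^-1 by rewrite invr_gt0; lra.
set x := Q^-1 in x0 x2 *; set p := (1 - x)^-1.
have p1 : 1 <= p by rewrite invf_ge1; lra.
have p0 : 0 < p by lra.
apply: (@le_trans _ _ (p * \sum_(j < L.+1) (p * x) ^+ j * x ^+ (j * (L - j)))).
  rewrite mulr_sumr; apply: ler_sum => j _; rewrite exprS -!mulrA ler_wpM2l //.
    exact: ltW.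
  rewrite exprMn -!mulrA ler_wpM2l ?exprn_ge0 ?(ltW p0) // -exprD.
  by rewrite ler_wiXn2l ?(ltW x0) //; [lra | rewrite mulnDr mulnS; lia].
rewrite exprS ler_wpM2l ?(ltW p0) //.
have [q_eq2|q_ne2] := eqVneq q 2%N.
  have xE : x = 2^-1 by rewrite /x /Q q_eq2.
  have pE : p = 2 by rewrite /p xE; field.
  rewrite pE {1}xE divff ?pnatr_eq0 //.
  have := @sum_two_ends _ x L (ltW x0); rewrite -/p pE => h.
  under eq_bigr do rewrite expr1n mul1r.
  by apply: le_trans (h _) _; lra.
have Q3 : 3 <= Q by rewrite ler_nat; lia.
have x3 : x <= 3^-1 by rewrite lef_pV2 ?posrE //; lra.
have pxE : p * x = x / (1 - x) by rewrite mulrC.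
have px1 : p * x < 1 by rewrite pxE ltr_pdivrMr; lra.
have px0 : 0 <= p * x by rewrite mulr_ge0 // ltW.
apply: (@le_trans _ _ (\sum_(j < L.+1) (p * x) ^+ j)).
  apply: ler_sum => j _; rewrite ler_piMr ?exprn_ge0 //.
  by rewrite exprn_ile1 ?(ltW x0) //; lra.
apply: le_trans (geometric_le _ px0 px1) _.
have -> : (1 - p * x)^-1 = (1 - x) / (1 - 2 * x).
  by rewrite /p; field; rewrite ?gt_eqF //; lra.
rewrite /p exprVn ler_pdivrMr; last by lra.
rewrite mulrC ler_pdivlMr; last by rewrite exprn_gt0 //; lra.
rewrite -exprS; nra.
Qed.

(** The left side is the exponent at dimension t + 1, the first two summands on
    the right are the exponent at dimension t + 1 + j, and the last one is the
    loss. *)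
Lemma layer_exponent (n k t L u j : nat) :
    (j <= L)%N -> k = (t + L.+1)%N -> n = (2 * k + 1 + u)%N ->
  (L * (n - k) + t.+1 =
     (j + t.+1) * j.+1 + (k - (j + t.+1)) * (n - k) + j * (L - j + u))%N.
Proof.
move=> jL -> ->; rewrite -(subnKC jL); move: (L - j)%N => c.
rewrite addKn (_ : t + (j + c).+1 - (j + t.+1) = c)%N; last by lia.
rewrite (_ : _ - _ = t + (j + c).+1 + 1 + u)%N; last by lia.
nia.
Qed.

Lemma peeling_sum_le (R : realFieldType) (Q : R) (n k t L u : nat) :
    2 <= Q -> (0 < t)%N -> k = (t + L.+1)%N -> n = (2 * k + 1 + u)%N ->
  \sum_(t.+1 <= i < k.+1) layer_bound Q t i * superspace_bound Q n k i <=
    (1 - Q^-1 - Q^-1 ^+ 2)^-1 ^+ 2 * Q ^+ (L * (n - k) + t.+1) *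
    \sum_(j < L.+1) (1 - Q^-1)^-1 ^+ j.+1 * Q^-1 ^+ (j * (L - j + u)).
Proof.
move=> Q2 t0 kE nE.
have Q0 : 0 < Q by lra.
have x2 : Q^-1 <= 2^-1 by rewrite lef_pV2 ?posrE //; lra.
have x0 : 0 < Q^-1 by rewrite invr_gt0.
have Q1 : 1 < Q by lra.
rewrite -{1}[t.+1]add0n big_addn big_mkord (_ : (k.+1 - t.+1)%N = L.+1); last first.
  by lia.
rewrite mulr_sumr; apply: ler_sum => j _; have jL := ltn_ord j.
set i := (j + t.+1)%N.
have lb : layer_bound Q t i <= _ := layer_bound_le Q2 (t := t) (i := i) _.
have sb : superspace_bound Q n k i <= _ :=
  superspace_bound_le Q2 (n := n) (k := k) (i := i) _.
apply: (le_trans (ler_pM _ _ (lb _) (sb _))).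
- by apply: prodr_ge0 => d _; rewrite avoid_ratio_ge0 //; lia.
- rewrite /superspace_bound big_nat; apply: prodr_ge0 => d /andP[_ dk].
  by rewrite avoid_ratio_ge0 //; lia.
- by lia.
- by lia.
rewrite (_ : i - t = j.+1)%N; last by lia.
rewrite [leRHS]mulrACA; have -> : Q ^+ (L * (n - k) + t.+1) * Q^-1 ^+ (j * (L - j + u)) =
    Q ^+ (i * j.+1) * Q ^+ ((k - i) * (n - k)).
  rewrite -exprD exprVn.
  have -> : (L * (n - k) + t.+1 =
      i * j.+1 + (k - i) * (n - k) + j * (L - j + u))%N.
    exact: layer_exponent.
  by rewrite [in LHS]exprD mulfK // expf_neq0 // gt_eqF.
rewrite le_eqVlt; apply/orP; left; apply/eqP; ring.
Qed.

Lemma boundC_factors (R : realFieldType) (Q : R) : 2 <= Q ->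
  Q / (Q - 1) = (1 - Q^-1)^-1 /\
  1 + (Q + 1) / (Q ^+ 2 - Q - 1) = (1 - Q^-1 - Q^-1 ^+ 2)^-1.
Proof.
move=> Q2; split; field; rewrite !gt_eqF //=; nra.
Qed.

Theorem theorem4p2 (R : realFieldType) (q : nat) (K : finFieldType)
    (hq : #|K| = q) (n k t : nat)
    (hn : (0 < n)%N) (hk : (0 < k)%N) (ht : (0 < t)%N)
    (hnk : (2 * k + 1 <= n)%N)
    (Fam : {set {vspace 'rV[K]_n}})
    (hFam : Fam \subset ksubspaces K n k)
    (hint : t_intersecting t Fam)
    (alpha : R) (halpha0 : 0 < alpha) (halpha1 : alpha < 1)
    (hfrac : forall T : {vspace 'rV[K]_n}, \dim T = t ->
       #|members_containing Fam T|%:R <= alpha * #|Fam|%:R) :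
  #|Fam|%:R <= boundC R q n k t * (1 - alpha)^-1
    * q%:R ^ ((k%:Z - t%:Z) * (n%:Z - k%:Z) - (n%:Z - k%:Z - t%:Z - 1)).
Proof.
have q2 : (1 < q)%N by rewrite -hq finNzRing_gt1.
have Q2 : 2 <= q%:R :> R by rewrite ler_nat.
have Q0 : 0 < q%:R :> R by lra.
have [pE DE] := boundC_factors Q2.
have p0 : 0 <= q%:R / (q%:R - 1) :> R by rewrite divr_ge0 ?(ltW Q0) //; lra.
have beta0 : 0 < 1 - alpha by lra.
have dimF X : X \in Fam -> \dim X = k.
  by move=> /(subsetP hFam); rewrite inE => /eqP.
have [-> | /set0Pn[X XF]] := eqVneq Fam set0.
  rewrite cards0 mulr_ge0 ?mulr_ge0 ?invr_ge0 ?exprz_ge0 ?(ltW Q0) ?(ltW beta0) //.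
  rewrite /boundC; case: ifP => _; last first.
    by rewrite mulr_ge0 ?(exprn_ge0 _ p0) ?exprn_even_ge0.
  by rewrite mulr_ge0 ?exprn_even_ge0 // mulr_ge0 ?exprz_ge0.
have tk : (t <= k)%N.
  by have := hint _ _ XF XF; rewrite capvv (dimF _ XF).
have := @peeling R K n k t k Fam Fam (alpha * #|Fam|%:R).
rewrite ht tk hq => /(_ isT _ _ hint _ hFam _ hfrac) peel.
have {}peel : (1 - alpha) * #|Fam|%:R <= \sum_(t.+1 <= i < k.+1)
    layer_bound (q%:R : R) t i * superspace_bound q%:R n k i.
  rewrite mulrBl mul1r lerBlDl; apply: peel.
  - by lia.
  - by rewrite mulr_ge0 // ltW.
  - by move=> Y /dimF ->.
  - by apply/refinesP => Y YF; exists Y.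
have F0 : 0 < #|Fam|%:R :> R by rewrite ltr0n card_gt0; apply/set0Pn; exists X.
have ltk : (t < k)%N.
  rewrite ltn_neqAle tk andbT; apply/eqP => tkE.
  move: peel; rewrite tkE big_geq // leNgt => /negP; apply.
  by rewrite mulr_gt0.
rewrite mulrAC ler_pdivlMr // mulrC; apply: (le_trans peel).
have [L kE] : exists L, k = (t + L.+1)%N by exists (k - t.+1)%N; lia.
have [u nE] : exists u, n = (2 * k + 1 + u)%N by exists (n - (2 * k + 1))%N; lia.
have expE : ((k%:Z - t%:Z) * (n%:Z - k%:Z) - (n%:Z - k%:Z - t%:Z - 1))%R =
    (L * (n - k) + t.+1)%N :> int.
  rewrite PoszD PoszM -subzn; last by lia.
  rewrite -[t.+1]addn1 kE !PoszD -addn1 PoszD; ring.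
rewrite expE -exprnP.
have := peeling_sum_le Q2 ht kE nE => sum_le.
apply: (le_trans sum_le); rewrite mulrAC ler_wpM2r ?exprn_ge0 ?(ltW Q0) //.
rewrite /boundC pE DE mulrC.
case: ifP => [/eqP n_eq | n_neq].
  have u0 : u = 0%N by lia.
  rewrite u0 ler_wpM2r ?exprn_even_ge0 //.
  have -> : (k%:Z - t%:Z + 1)%R = L.+2 :> int.
    by rewrite kE !PoszD; lia.
  rewrite -exprnP; under eq_bigr do rewrite addn0.
  exact: layer_sum_critical.
case: u nE sum_le {expE} => [|u] nE _; first by move/eqP: n_neq; lia.
rewrite ler_wpM2r ?exprn_even_ge0 //; exact: layer_sum_large.
Qed.
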